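(* Let $G_2$ be a finite purely non-abelian group which acts trivially on a finite abelian group $G_1$, and let $\varepsilon_1,\varepsilon_2\in Z^2(G_2,G_1)$. Let $\sigma\in \mathrm{Aut}(G_1)$, $\eta\in \mathrm{Hom}(G_2,G_1)$, $\delta\in \mathrm{Hom}(G_1,G_2)$, $\rho\in \mathrm{Aut}(G_2)$ be such that: (1) $[\{1\}\times G_2,\ \{1\}\times\delta(G_1)]=1$, i.e. in the group $G_1\underset{\varepsilon_2}{\times}G_2$ every element of $\{1\}\times G_2$ commutes with every element of $\{1\}\times\delta(G_1)$; (2) $\varepsilon_2\circ(\delta\times\delta)=1$ and $\delta\circ\varepsilon_1=1$; (3) $\sigma\circ\varepsilon_1=\varepsilon_2\circ(\rho\times\rho)$. Let $\varphi=\begin{pmatrix}\sigma&\eta\\ \delta&\rho\end{pmatrix}$, that is, the map $$\varphi(x,y)=\bigl(\sigma(x)\,\eta(y)\,\varepsilon_2(\delta(x),\rho(y)),\ \delta(x)\rho(y)\bigr),\qquad x\in G_1,\ y\in G_2.$$ Then $\varphi$ is an isomorphism from $G_1\underset{\varepsilon_1}{\times}G_2$ to $G_1\underset{\varepsilon_2}{\times}G_2$.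
   Context: Groups are written multiplicatively; $1$ also denotes the constant map with value $1$. For a group $G_2$ acting trivially on an abelian group $G_1$, $Z^2(G_2,G_1)$ is the set of normalized 2-cocycles: maps $\varepsilon:G_2\times G_2\to G_1$ with $\varepsilon(h,g)\varepsilon(hg,k)=\varepsilon(g,k)\varepsilon(h,gk)$ for all $g,h,k\in G_2$ and $\varepsilon(g,1)=\varepsilon(1,g)=1$ for all $g\in G_2$. For $\varepsilon\in Z^2(G_2,G_1)$, the central extension $G_1\underset{\varepsilon}{\times}G_2$ is the set $G_1\times G_2$ with the group operation $(x,y)(x',y')=(xx'\varepsilon(y,y'),yy')$. A non-abelian group with no non-trivial abelian direct factor is called purely non-abelian. *)

(* Defs.v *)
From HB Require Import structures.
From mathcomp Require Import all_boot all_fingroup.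

Set Implicit Arguments.
Unset Strict Implicit.
Unset Printing Implicit Defensive.

Local Open Scope group_scope.

Definition purely_nonabelian (gT : finGroupType) (G : {set gT}) : Prop :=
  ~~ abelian G /\
  (forall A B : {group gT}, A \x B = G -> abelian A -> A :=: 1).

(* Z^2(gT2, gT1) for the trivial action of gT2 on gT1. *)
Record two_cocycle (gT2 gT1 : finGroupType) := TwoCocycle {
  two_cocycle_fun :> gT2 -> gT2 -> gT1;
  two_cocycleM : forall h g k : gT2,
    two_cocycle_fun h g * two_cocycle_fun (h * g) k
      = two_cocycle_fun g k * two_cocycle_fun h (g * k);
  two_cocycle_g1 : forall g : gT2, two_cocycle_fun g 1 = 1;
  two_cocycle_1g : forall g : gT2, two_cocycle_fun 1 g = 1
}.

(* A wrapper around gT1 * gT2, so as not to pick up the direct product group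
   structure that MathComp puts on pairs. The argument abG1 is a parameter of
   the type because the twisted product is associative only for abelian gT1. *)
Record central_ext (gT1 gT2 : finGroupType) (abG1 : abelian [set: gT1])
    (eps : two_cocycle gT2 gT1) :=
  CentralExt { pair_of_cext : gT1 * gT2 }.
Add Printing Constructor central_ext.

HB.instance Definition _ (gT1 gT2 : finGroupType) (abG1 : abelian [set: gT1])
    (eps : two_cocycle gT2 gT1) :=
  [isNew for @pair_of_cext gT1 gT2 abG1 eps].
HB.instance Definition _ (gT1 gT2 : finGroupType) (abG1 : abelian [set: gT1])
    (eps : two_cocycle gT2 gT1) :=
  [Finite of central_ext abG1 eps by <:].

Section CentralExtGroup.

Context (gT1 gT2 : finGroupType) (abG1 : abelian [set: gT1]).
Context (eps : two_cocycle gT2 gT1).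
Local Notation E := (central_ext abG1 eps).

Definition cext_mul (u v : E) : E :=
  let: (x, y) := pair_of_cext u in
  let: (x', y') := pair_of_cext v in
  CentralExt abG1 eps (x * x' * eps y y', y * y').

Definition cext_one : E := CentralExt abG1 eps (1, 1).

Definition cext_inv (u : E) : E :=
  let: (x, y) := pair_of_cext u in
  CentralExt abG1 eps (x^-1 * (eps y^-1 y)^-1, y^-1).

Let mulC (x y : gT1) : x * y = y * x.
Proof. by apply: (centsP abG1); rewrite inE. Qed.

Lemma cext_mulA : associative cext_mul.
Proof.
case=> [[x1 y1]] [[x2 y2]] [[x3 y3]]; rewrite /cext_mul /= !mulgA.
congr (CentralExt _ _ (_, _)); rewrite -!mulgA; congr (_ * (_ * _)).
by rewrite [RHS]mulgA [eps y1 y2 * x3]mulC -mulgA two_cocycleM.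
Qed.

Lemma cext_mul1 : left_id cext_one cext_mul.
Proof.
by case=> [[x y]]; rewrite /cext_mul /= !mul1g two_cocycle_1g mulg1.
Qed.

Lemma cext_mulV : left_inverse cext_one cext_inv cext_mul.
Proof.
case=> [[x y]]; rewrite /cext_mul /cext_inv /cext_one /= mulVg.
congr (CentralExt _ _ (_, _)).
by rewrite -mulgA [x * _]mulC mulgA -(mulgA x^-1) mulVg mulg1 mulVg.
Qed.

HB.instance Definition _ :=
  Finite_isGroup.Build E cext_mulA cext_mul1 cext_mulV.

End CentralExtGroup.

(* The map given by the matrix (sigma, eta ; delta, rho): the cocycle factor is
   the one of the product (sigma x, delta x) * (eta y, rho y) in the target. *)
Definition cext_matrix_map (gT1 gT2 : finGroupType)
    (abG1 : abelian [set: gT1]) (eps1 eps2 : two_cocycle gT2 gT1)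
    (sigma : gT1 -> gT1) (eta : gT2 -> gT1)
    (delta : gT1 -> gT2) (rho : gT2 -> gT2)
    (u : central_ext abG1 eps1) : central_ext abG1 eps2 :=
  let: (x, y) := pair_of_cext u in
  CentralExt abG1 eps2
    (sigma x * eta y * eps2 (delta x) (rho y), delta x * rho y).

(* Main.v *)
Require Import Defs.
From HB Require Import structures.
From mathcomp Require Import all_boot all_fingroup center.

Local Open Scope group_scope.

(** Write phi (x, y) = a x * b y, where a x = (sigma x, delta x) and
    b y = (eta y, rho y) are computed in the extension by eps2.  The map a is a
    morphism because eps2 is trivial on the image of delta.  The map b fails to
    be one exactly by the cocycle eps2 (rho y) (rho y') = sigma (eps1 y y'),
    which is a (eps1 y y') because delta kills eps1; this defect is what the
    product of the source extension compensates.  As the elements (1, delta x)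
    commute with all (1, y), the values of a are central, and phi is a morphism
    (cext_matrix_mapM).

    The two extensions have the same order, so it remains to see that phi has a
    trivial kernel (cext_matrix_map_ker).  If phi (x, y) = 1 then
    rho y = delta x^-1 and sigma x = (eta y)^-1, so y is a fixed point of the
    endomorphism rho^-1 o delta o sigma^-1 o eta of the second group.  The image
    of delta is central, hence so is the image of this endomorphism.  By a
    Fitting-type argument, an endomorphism with central image of a purely
    non-abelian group fixes only 1 (central_endo_fixed_point).  So y = 1, and
    then x = 1. *)

Set Implicit Arguments.
Unset Strict Implicit.
Unset Printing Implicit Defensive.

(** The image meets the kernel trivially, commutes with it because it is central,
    and the product of their orders is the order of G. *)
Lemma dprod_morphim_ker (gT : finGroupType) (G : {group gT})
    (f : {morphism G >-> gT}) :
  f @* G \subset 'Z(G) -> 'ker f :&: f @* G = 1 -> f @* G \x 'ker f = G.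
Proof.
move=> fZ tiKI; have /subsetIP[sIG cIG] := fZ.
have sKG : 'ker f \subset G by apply: subsetIl.
rewrite dprodE; first last.
- by rewrite setIC.
- by rewrite (subset_trans sKG) // centsC.
apply/eqP; rewrite eqEcard mul_subG //= TI_cardMg 1?setIC //.
by rewrite card_morphim setIid mulnC Lagrange.
Qed.

(** Either f is injective on its own image, which is then an abelian direct factor
    of G and so is trivial, or f o f has a strictly smaller image, which
    is again central, and f o f still fixes x: induct on the order of the image. *)
Lemma central_endo_fixed_point (gT : finGroupType) (G : {group gT})
    (f : {morphism G >-> gT}) (x : gT) :
  purely_nonabelian G -> f @* G \subset 'Z(G) -> x \in G -> f x = x -> x = 1.
Proof.
move=> [_ pnaG]; have [n] := ubnP #|f @* G|.
elim: n f => // n IHn f lefGn fZ Gx fx.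
have /subsetIP[sfG _] := fZ.
have [tiKI | ntKI] := eqVneq ('ker f :&: f @* G) 1.
  have abfG : abelian (f @* G) := abelianS fZ (center_abelian G).
  have fG1 := pnaG (f @* G)%G ('ker f)%G (dprod_morphim_ker fZ tiKI) abfG.
  by apply/set1gP; rewrite -fG1 -fx mem_morphim.
have sGff : G \subset 'dom (f \o f) by rewrite -sub_morphim_pre.
have ffG : restrm sGff (f \o f) @* G = f @* (f @* G).
  by rewrite morphim_restrm setIid morphim_comp.
apply: (IHn (restrm_morphism sGff (comp_morphism f f))) => //=.
- rewrite ffG; apply: leq_trans (lefGn : #|f @* G| <= n).
  rewrite (card_morphim f (f @* G)%G) (setIidPr sfG) -divgI setIC.
  by rewrite ltn_Pdiv ?cardG_gt0 ?cardG_gt1.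
- by rewrite ffG (subset_trans _ fZ) // morphimS.
- by rewrite /restrm /= !fx.
Qed.

Section MatrixMap.

Context (gT1 gT2 : finGroupType) (abG1 : abelian [set: gT1]).

Lemma cext_mulE (eps : two_cocycle gT2 gT1) (x x' : gT1) (y y' : gT2) :
  CentralExt abG1 eps (x, y) * CentralExt abG1 eps (x', y')
    = CentralExt abG1 eps (x * x' * eps y y', y * y').
Proof. by []. Qed.

Lemma mulgC_abelian (x x' : gT1) : x * x' = x' * x.
Proof. by apply: (centsP abG1); rewrite inE. Qed.

(** The first factor is central, so first components cannot affect commutation. *)
Lemma cext_commute (eps : two_cocycle gT2 gT1) (x x' : gT1) (y z : gT2) :
  commute (CentralExt abG1 eps (1, y)) (CentralExt abG1 eps (1, z)) ->
  commute (CentralExt abG1 eps (x, y)) (CentralExt abG1 eps (x', z)).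
Proof.
rewrite /commute !cext_mulE !mul1g => -[eps_yz yz].
by rewrite eps_yz yz (mulgC_abelian x).
Qed.

Lemma card_cext (eps : two_cocycle gT2 gT1) :
  #|[set: central_ext abG1 eps]| = (#|gT1| * #|gT2|)%N.
Proof.
rewrite cardsT -card_prod; apply: (@bij_eq_card _ _ (@pair_of_cext _ _ abG1 eps)).
by exists (CentralExt abG1 eps) => // -[].
Qed.

Context (eps1 eps2 : two_cocycle gT2 gT1).
Context (sigma : {morphism [set: gT1] >-> gT1}).
Context (eta : {morphism [set: gT2] >-> gT1}).
Context (delta : {morphism [set: gT1] >-> gT2}).
Context (rho : {morphism [set: gT2] >-> gT2}).
Context (comm_delta : forall x y,
  commute (CentralExt abG1 eps2 (1, y)) (CentralExt abG1 eps2 (1, delta x))).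
Context (eps2_delta : forall x x', eps2 (delta x) (delta x') = 1).

Local Notation phi := (@cext_matrix_map _ _ abG1 eps1 eps2 sigma eta delta rho).

Lemma delta_central x y : commute y (delta x).
Proof. by have [] := comm_delta x y. Qed.

(** The map is the product of a morphism a with central values and of a map b
    whose defect of multiplicativity is a (eps1 y y'). *)
Lemma cext_matrix_mapM :
  (forall y y', delta (eps1 y y') = 1) ->
  (forall y y', sigma (eps1 y y') = eps2 (rho y) (rho y')) ->
  {morph phi : u v / u * v}.
Proof.
move=> delta_eps1 sigma_eps1.
pose a x := CentralExt abG1 eps2 (sigma x, delta x).
pose b y := CentralExt abG1 eps2 (eta y, rho y).
have phiE x y : phi (CentralExt abG1 eps1 (x, y)) = a x * b y by [].
have aM x x' : a (x * x') = a x * a x'.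
  by rewrite /a cext_mulE eps2_delta mulg1 !morphM ?inE.
have bM y y' : b y * b y' = a (eps1 y y') * b (y * y').
  rewrite /a /b !cext_mulE delta_eps1 sigma_eps1 two_cocycle_1g mulg1 mul1g.
  by rewrite !morphM ?inE // (mulgC_abelian (eps2 _ _)).
have ab x y : b y * a x = a x * b y by apply: cext_commute.
case=> [[x y]] [[x' y']]; rewrite cext_mulE !phiE !aM -!mulgA -bM.
by rewrite (mulgA (a x')) -(ab x' y) -!mulgA.
Qed.

(** A kernel element (x, y) makes y a fixed point of an endomorphism that factors
    through delta, and so has central image. *)
Lemma cext_matrix_map_ker (sigma' : {morphism [set: gT1] >-> gT1})
    (rho' : {morphism [set: gT2] >-> gT2}) :
  purely_nonabelian [set: gT2] ->
  cancel sigma sigma' -> cancel rho rho' -> cancel rho' rho ->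
  forall u, phi u = 1 -> u = 1.
Proof.
move=> pnaG2 sigmaK rhoK rhoK' [[x y]].
rewrite /cext_matrix_map /= => -[phi1 phi2].
have rho_y : rho y = delta x^-1.
  by rewrite morphV ?inE //; apply/esym/eqP; rewrite eq_invg_mul phi2.
have sigma_x : sigma x = (eta y)^-1.
  (* Here delta x and rho y both lie in the image of delta, where eps2 is 1. *)
  move: phi1; rewrite rho_y eps2_delta mulg1 => phi1.
  by apply/eqP; rewrite eq_mulgV1 invgK phi1.
have x_eta : x = (sigma' (eta y))^-1 by rewrite -(sigmaK x) sigma_x morphV ?inE.
pose f z := rho' (delta (sigma' (eta z))).
have fM : {in [set: gT2] &, {morph f : z t / z * t}}.
  by move=> z t _ _; rewrite /f !morphM ?inE.
have y1 : y = 1.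
  apply: (@central_endo_fixed_point _ [set: gT2]%G (Morphism fM) y) => //=.
    apply/subsetP=> _ /morphimP[z _ _ ->]; apply/centerP.
    split; rewrite ?inE //= => t _.
    apply: (can_inj rhoK); rewrite /f !morphM ?inE // rhoK'.
    exact/esym/delta_central.
  by rewrite /f -[RHS]rhoK rho_y x_eta invgK.
by rewrite x_eta y1 !morph1 invg1.
Qed.

End MatrixMap.

Theorem theorem4p2 (gT1 gT2 : finGroupType)
    (abG1 : abelian [set: gT1]) (pnaG2 : purely_nonabelian [set: gT2])
    (eps1 eps2 : two_cocycle gT2 gT1)
    (sigma : {perm gT1}) (Aut_sigma : sigma \in Aut [set: gT1])
    (eta : {morphism [set: gT2] >-> gT1})
    (delta : {morphism [set: gT1] >-> gT2})
    (rho : {perm gT2}) (Aut_rho : rho \in Aut [set: gT2])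
    (comm_delta :
       [~: [set CentralExt abG1 eps2 (1, y) | y in [set: gT2]],
           [set CentralExt abG1 eps2 (1, z) | z in delta @* [set: gT1]]] = 1)
    (eps2_delta : forall x x' : gT1, eps2 (delta x) (delta x') = 1)
    (delta_eps1 : forall y y' : gT2, delta (eps1 y y') = 1)
    (sigma_eps1 : forall y y' : gT2, sigma (eps1 y y') = eps2 (rho y) (rho y')) :
  misom [set: central_ext abG1 eps1] [set: central_ext abG1 eps2]
    (cext_matrix_map eps2 sigma eta delta rho).
Proof.
pose s := autm_morphism Aut_sigma; pose s' := autm_morphism (groupVr Aut_sigma).
pose r := autm_morphism Aut_rho; pose r' := autm_morphism (groupVr Aut_rho).
have comm x y :
    commute (CentralExt abG1 eps2 (1, y)) (CentralExt abG1 eps2 (1, delta x)).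
  have /centsP cd := introT commG1P comm_delta.
  by apply: cd; apply: imset_f; rewrite ?inE ?mem_morphim ?inE.
have phiM := @cext_matrix_mapM _ _ abG1 eps1 eps2 s eta delta r comm eps2_delta
  delta_eps1 sigma_eps1.
have phiK := @cext_matrix_map_ker _ _ abG1 eps1 eps2 s eta delta r comm eps2_delta
  s' r' pnaG2 (permK sigma) (permK rho) (permKV rho).
have phi_morphic : morphic [set: central_ext abG1 eps1]
    (cext_matrix_map eps2 sigma eta delta rho).
  by apply/morphicP=> u v _ _; apply: phiM.
apply/misomP; exists phi_morphic.
have inj : 'injm (morphm phi_morphic).
  by apply/subsetP=> u /morphpreP[_ /set1P phi_u]; apply/set1P/phiK.
apply/isomP; split=> //; apply/eqP.
by rewrite eqEcard subsetT card_injm ?subxx // !card_cext leqnn.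
Qed.
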